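(* Let $u:\mathbb{R}_{\ge 0}\to[0,1]$ be non-increasing with $u(0)=1$ and $\lim_{t\to\infty}u(t)=0$, and let there be $n$ algorithms with runtime distributions $\mathcal{D}_1,\dots,\mathcal{D}_n$ and expected utilities $U_i=\mathbb{E}_{t\sim\mathcal{D}_i}[u(t)]$. Given $\epsilon,\delta\in(0,1)$ and a captime $\kappa$ with $u(\kappa)<\epsilon$, the Naive procedure sets $m=\Big\lceil\frac{2\ln(2n/\delta)}{(\epsilon-u(\kappa))^2}\Big\rceil$, runs each algorithm $i$ on $m$ instances at captime $\kappa$, obtaining independent capped samples $t_{ij}(\kappa)=\min(t_{ij},\kappa)$ with $t_{ij}\sim\mathcal{D}_i$, computes $\widehat{U}_{im}(\kappa)=\frac1m\sum_{j=1}^m u(t_{ij}(\kappa))$, and returns $i^*\in\arg\max_i\widehat{U}_{im}(\kappa)$. Then with probability at least $1-\delta$ the Naive procedure returns an $\epsilon$-optimal algorithm, and the number $m$ of $\kappa$-capped samples it takes of each algorithm satisfies $$2\sqrt{\frac{\ln(2n/\delta)}{2m}}+u(\kappa)\le\epsilon.$$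
   Context: The runtime distribution $\mathcal{D}_i$ of algorithm $i$ is induced by drawing instances i.i.d. from a fixed instance distribution (and any internal randomness). An algorithm $i^*$ is $\epsilon$-optimal if $U_{i^*}\ge\max_iU_i-\epsilon$. *)

(* Defs.v *)
From HB Require Import structures.
From mathcomp Require Import all_boot all_order all_algebra.
From mathcomp Require Import all_classical all_reals all_analysis.
Set Implicit Arguments. Unset Strict Implicit. Unset Printing Implicit Defensive.
Import Order.TTheory GRing.Theory Num.Theory.
Local Open Scope classical_set_scope.
Local Open Scope ring_scope.

Definition naive_m {R : realType} (n : nat) (delta eps ukappa : R) : nat :=
  `| Num.ceil (2 * ln (2 * n%:R / delta) / (eps - ukappa) ^+ 2) |%N.

(* Mutual independence of a finite family of real random variables:
   for every family of Borel sets, the joint probability factorises.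
   (Taking B i = setT recovers the product rule for every sub-family.) *)
Definition mutually_independent {d : measure_display} {T : measurableType d}
  {R : realType} (P : probability T R) (I : finType) (X : I -> T -> R) : Prop :=
  forall B : I -> set R, (forall i, measurable (B i)) ->
    P [set w | forall i, B i (X i w)] = (\prod_(i : I) P [set w | B i (X i w)])%E.

Definition nonneg_reals (R : realType) : set R := [set t : R | 0 <= t].

(* Expected utility U_i = E_{t ~ D_i}[u(t)] (runtimes are nonnegative). *)
Definition expected_utility {R : realType} (D : probability R R) (u : R -> R) : \bar R :=
  (\int[D]_(t in @nonneg_reals R) (u t)%:E)%E.

Definition emp_utility {R : realType} (m : nat) (u : R -> R) (kappa : R)
  (t : 'I_m -> R) : R :=
  (m%:R)^-1 * \sum_(j < m) u (Num.min (t j) kappa).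

(* Main.v *)
(* Let v t = u (min t kappa). Since u is non-increasing,
   u t <= v t <= u t + u kappa, so the capped expected utility p_i satisfies
   U_i <= p_i <= U_i + u kappa. By Hoeffding's inequality the empirical mean of
   v (t_ij) over j is off p_i by g / 2 or more, g = eps - u kappa, with
   probability at most delta / (2 n) on either side, because
   m g^2 / 2 >= ln (2 n / delta). Off these 2 n events, any maximiser of the
   empirical utility is eps-optimal. Hoeffding's inequality is obtained by the
   Chernoff method, for which independence, given as a product rule on events,
   is upgraded to a product rule for expectations. *)

Require Import Defs.
From HB Require Import structures.
From mathcomp Require Import all_boot all_order all_algebra.
From mathcomp Require Import all_classical all_reals all_analysis.
From mathcomp Require Import finmap measurable_realfun ring lra.
Import Order.TTheory GRing.Theory Num.Theory.
Import numFieldNormedType.Exports HBNNSimple.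
Local Open Scope classical_set_scope.
Local Open Scope ring_scope.

(** * The logarithm of the Bernoulli moment generating function *)

Lemma ge0_is_derive_ge (R : realType) (f df : R -> R) (a : R) :
  (forall x, is_derive x (1 : R) f (df x)) -> (forall x, 0 <= x -> 0 <= df x) ->
  0 <= a -> f 0 <= f a.
Proof.
move=> fdf df0 a0.
have cf : {within `[0, a], continuous f}.
  apply: continuous_subspaceT => y; apply: differentiable_continuous.
  by apply/derivable1_diffP; case: (fdf y).
have [c + eq_c] := MVT_segment a0 (fun x _ => fdf x) cf.
rewrite in_itv/= => /andP[c0 _].
by rewrite -subr_ge0 eq_c mulr_ge0 ?subr_ge0 ?df0.
Qed.

(** The gap [f] between the two sides and its derivative [df] both vanish at 0, and the second
    derivative [ddf] is nonnegative. Monotonicity on the nonnegative half-line, applied first to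
    [df] and then to [f], gives the bound. *)
Lemma ln_bernoulli_mgf_le (R : realType) (p l : R) : 0 <= p <= 1 -> 0 <= l ->
  ln (1 - p + p * expR l) <= p * l + l ^+ 2 / 8.
Proof.
move=> /andP[p0 p1] l0.
pose D (t : R) := 1 - p + p * expR t.
have D0 t : 0 < D t.
  rewrite /D; have := expR_gt0 t; have [->|pn1] := eqVneq p 1; first by lra.
  move=> e0; apply: ltr_pwDl; last by rewrite mulr_ge0// ltW.
  by rewrite subr_gt0 lt_neqAle pn1.
have dD t : is_derive t (1 : R) D (p * expR t).
  rewrite /D; apply: is_derive_eq.
  by rewrite add0r /GRing.scale/= ; ring.
pose f (t : R) := p * t + t ^+ 2 / 8 - (@ln R \o D) t.
pose df (t : R) := p + t / 4 - p * expR t / D t.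
have fdf t : is_derive t (1 : R) f (df t).
  have dln : is_derive t (1 : R) (@ln R \o D) (p * expR t / D t).
    apply: is_derive_eq; first by apply: is_derive1_comp; exact: is_derive1_ln.
    by rewrite /GRing.scale/=; ring.
  rewrite /f /df; apply: is_derive_eq.
  by rewrite /GRing.scale/=; field; rewrite gt_eqF.
(* With q = p e^t / D t, df' = 1/4 - q (1 - q). *)
pose ddf (t : R) := 4^-1 - p * expR t * (1 - p) / D t ^+ 2.
have dfddf t : is_derive t (1 : R) df (ddf t).
  have Dn0 : D t != 0 by rewrite gt_eqF.
  have dV : is_derive t (1 : R) (fun t => (D t)^-1) (- (D t) ^- 2 * (p * expR t)).
    exact: is_deriveV.
  rewrite /df /ddf; apply: is_derive_eq.
  rewrite /GRing.scale/=.
  have De : D t = 1 - p + p * expR t by [].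
  have -> : p * expR t = D t - 1 + p by rewrite De; ring.
  by field.
have ddf0 t : 0 <= ddf t.
  rewrite /ddf subr_ge0 ler_pdivrMr ?exprn_gt0// /D.
  (* This is [a * b <= (a + b) ^+ 2 / 4] with [a = 1 - p] and [b = p * expR t], whose sum is
     [D t]. *)
  have := sqr_ge0 (1 - p - p * expR t); nra.
have df_ge0 t : 0 <= t -> 0 <= df t.
  move=> t0; have -> : 0 = df 0 by rewrite /df /D expR0; field; rewrite subrK oner_neq0.
  exact: (@ge0_is_derive_ge _ df ddf).
have f0 : f 0 = 0.
  by rewrite /f /= /D expR0 mulr1 subrK ln1 mulr0 expr0n mul0r addr0 subr0.
have := @ge0_is_derive_ge _ f df l fdf df_ge0 l0.
by rewrite f0 /f /= subr_ge0.
Qed.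

(** * From product rules on events to product rules on expectations *)

Lemma integral_indic_comp (R : realType) (d d' : measure_display)
    (T : measurableType d) (U : measurableType d') (P : {measure set T -> \bar R})
    (X : T -> U) (B : set U) :
  measurable_fun setT X -> measurable B ->
  (\int[P]_w (\1_B (X w))%:E = P (X @^-1` B))%E.
Proof.
move=> mX mB.
have mXB : measurable (X @^-1` B) by rewrite -[X in measurable X]setTI; exact: mX.
by rewrite -[X in _ = P X]setIT -(@integral_indic _ _ _ P setT).
Qed.

Section integral_weight.
Context (R : realType) (d d' : measure_display).
Context (T : measurableType d) (U : measurableType d').
Context (P : {measure set T -> \bar R}) (X : T -> U).
Hypothesis mX : measurable_fun setT X.

(** Linearity over the level sets of [f]: only integrals of the weight [G] against indicators
    remain, and on those independence can act. *)
Lemma integral_weight_nnsfun (G : T -> R) (f : {nnsfun U >-> R}) :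
  measurable_fun setT G -> (forall w, 0 <= G w) ->
  let s := enum_fset (fset_set (range f)) in
  (\int[P]_w (G w * f (X w))%:E =
   \sum_(k < size s)
     (s`_k)%:E * \int[P]_w (G w * \1_(f @^-1` [set s`_k]) (X w))%:E)%E.
Proof.
move=> mG G0 s.
have s0 (k : 'I_(size s)) : 0 <= s`_k.
  have : s`_k \in fset_set (range f) by exact: mem_nth.
  by rewrite in_fset_set// => /set_mem[x _ <-].
have mI k : measurable_fun setT
    (fun w => (G w * \1_(f @^-1` [set s`_k]) (X w))%:E).
  apply/measurable_EFinP; apply: measurable_funM => //.
  by apply: measurableT_comp => //; exact: measurable_indic.
have I0 k w : (0 <= (G w * \1_(f @^-1` [set s`_k]) (X w))%:E)%E.
  by rewrite lee_fin mulr_ge0// indicE.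
under eq_integral => w _.
  rewrite fimfunEord -/s mulr_sumr -sumEFin.
  under eq_bigr do rewrite mulrCA EFinM.
  over.
rewrite ge0_integral_sum//; last 2 first.
- by move=> k; exact: measurable_funeM.
- by move=> k w _; rewrite mule_ge0// lee_fin.
by apply: eq_bigr => k _; rewrite ge0_integralZl_EFin.
Qed.

(** Monotone convergence: a nonnegative weight keeps the simple approximations of [h] increasing. *)
Lemma cvg_integral_weight (G : T -> R) (h : U -> R)
    (mh : measurable_fun [set: U] (EFin \o h)) :
  measurable_fun setT G -> (forall w, 0 <= G w) -> (forall x, 0 <= h x) ->
  ((\int[P]_w (G w * nnsfun_approx measurableT mh n (X w))%:E) @[n --> \oo] -->
    \int[P]_w (G w * h (X w))%:E)%E.
Proof.
move=> mG G0 h0.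
have -> : (\int[P]_w (G w * h (X w))%:E = \int[P]_w
    (limn (fun n => (G w * nnsfun_approx measurableT mh n (X w))%:E)))%E.
  apply: eq_integral => w _; apply/esym/cvg_lim => //.
  under eq_fun do rewrite EFinM; rewrite EFinM; apply: cvgeZl => //.
  by apply: cvg_nnsfun_approx => // x _; rewrite lee_fin.
apply: cvg_monotone_convergence => //.
- move=> n; apply/measurable_EFinP; apply: measurable_funM => //.
  exact: measurableT_comp.
- by move=> n x _; rewrite lee_fin mulr_ge0.
- move=> x _ a b ab; rewrite lee_fin ler_wpM2l//.
  exact/lefP/nd_nnsfun_approx.
Qed.

(** Agreement of two weights on indicators passes to simple functions by linearity, then to [h] by
    uniqueness of the limit. This frees one factor of a product from being an indicator. *)
Lemma eq_integral_weight (G1 G2 : T -> R) (h : U -> R) :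
  measurable_fun setT G1 -> (forall w, 0 <= G1 w) ->
  measurable_fun setT G2 -> (forall w, 0 <= G2 w) ->
  (forall B, measurable B -> \int[P]_w (G1 w * \1_B (X w))%:E =
                             \int[P]_w (G2 w * \1_B (X w))%:E)%E ->
  measurable_fun setT h -> (forall x, 0 <= h x) ->
  (\int[P]_w (G1 w * h (X w))%:E = \int[P]_w (G2 w * h (X w))%:E)%E.
Proof.
move=> mG1 G10 mG2 G20 G12 /measurable_EFinP mh h0.
have := cvg_integral_weight _ _ mh mG1 G10 h0.
under [X in X @ _ --> _]eq_fun => n.
  rewrite integral_weight_nnsfun//.
  under eq_bigr do rewrite G12//.
  rewrite -integral_weight_nnsfun//; over.
by move=> /cvg_unique; apply => //; exact: cvg_integral_weight.
Qed.

End integral_weight.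

(** When all factors are indicators, the claim is independence itself. To free factor [k], two
    weights against functions of [X k] are compared: the product [G] of the other factors, and the
    constant [c], the product of their expectations, which is finite by assumption. *)
Lemma integral_prod_indep (R : realType) (d : measure_display)
    (T : measurableType d) (P : probability T R) (I : finType)
    (X : I -> T -> R) (g : I -> R -> R) :
  mutually_independent P X -> (forall i, measurable_fun setT (X i)) ->
  (forall i, measurable_fun setT (g i)) -> (forall i x, 0 <= g i x) ->
  (forall i, \int[P]_w (g i (X i w))%:E < +oo)%E ->
  (\int[P]_w (\prod_i g i (X i w))%:E = \prod_i \int[P]_w (g i (X i w))%:E)%E.
Proof.
move=> indX mX mg g0 gfin.
(* Induction on the list of factors that need not be indicators. *)
have : forall i, i \notin enum I -> exists B, measurable B /\ g i = \1_B.
  by move=> i; rewrite mem_enum.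
elim: (enum I) g mg g0 gfin => [|k s IH] g mg g0 gfin gI.
  have /choice[B gB] : forall i, exists B, measurable B /\ g i = \1_B.
    by move=> i; exact: gI.
  have mB i : measurable (B i) by have [] := gB i.
  have -> : (fun w => (\prod_i g i (X i w))%:E) =
      (fun w => (\1_[set w | forall i, B i (X i w)] w)%:E).
    apply/funext => w; congr EFin; rewrite indicE.
    have [BX|] := pselect (forall i, B i (X i w)).
    - rewrite mem_set// big1// => i _; have [_ ->] := gB i.
      by rewrite indicE (mem_set (BX i)).
    - move=> /[dup] nBX /existsNP[i BX]; rewrite memNset//.
      rewrite (bigD1 i)//=; have [_ ->] := gB i.
      by rewrite indicE memNset// mul0r.
  have mXB i : measurable (X i @^-1` B i).
    by rewrite -[X in measurable X]setTI; exact: mX.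
  rewrite integral_indic//; last first.
    have -> : [set w | forall i, B i (X i w)] =
        \bigcap_(i in [set: I]) (X i @^-1` B i).
      by apply/seteqP; split => [w BX i _|w BX i]; exact: BX.
    exact: fin_bigcap_measurable.
  rewrite setIT; apply: (eq_trans (indX B mB)); apply: eq_bigr => i _.
  have [_ ->] := gB i.
  by rewrite integral_indic_comp.
pose G w := \prod_(i | i != k) g i (X i w).
have mgX i : measurable_fun setT (fun w => g i (X i w)).
  exact: measurableT_comp.
have mG : measurable_fun setT G.
  have -> : G = fun w => \prod_(i <- enum (predC1 k)) g i (X i w).
    by apply/funext => w; rewrite big_enum.
  by apply: measurable_prod => i _; exact: mgX.
have G0 w : 0 <= G w by exact: prodr_ge0.
have E0 i : (0 <= \int[P]_w (g i (X i w))%:E)%E.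
  by apply: integral_ge0 => w _; rewrite lee_fin.
pose c := (\prod_(i | i != k) \int[P]_w (g i (X i w))%:E)%E.
have c0 : (0 <= c)%E by exact: prode_ge0.
have cfin : c \is a fin_num.
  by apply: prode_fin_num => i _; rewrite ge0_fin_numE.
have GE (h : R -> R) : (\int[P]_w (\prod_i
    (fun i => if i == k then h else g i) i (X i w))%:E =
    \int[P]_w (G w * h (X k w))%:E)%E.
  apply: eq_integral => w _; congr EFin; rewrite (bigD1 k)//= eqxx mulrC.
  by congr (_ * _); apply: eq_bigr => i /negbTE ->.
have cE (h : R -> R) : measurable_fun setT h -> (forall x, 0 <= h x) ->
    (\prod_i \int[P]_w ((fun i => if i == k then h else g i) i (X i w))%:E =
     \int[P]_w (fine c * h (X k w))%:E)%E.
  move=> mh h0; rewrite (bigD1 k)//= eqxx muleC.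
  under [RHS]eq_integral do rewrite EFinM.
  rewrite ge0_integralZl_EFin ?fine_ge0//; last 2 first.
  - by move=> w _; rewrite lee_fin.
  - by apply/measurable_EFinP; exact: measurableT_comp.
  rewrite fineK//; congr (_ * _)%E.
  by apply: eq_bigr => i /negbTE ->.
(* Written as its own update at [k], the family [g] falls under [GE] and [cE], just like the family
   with an indicator at [k]. *)
have gk : g = fun i => if i == k then g k else g i.
  by apply/funext => i; case: eqP => [->|].
rewrite [in LHS]gk [in RHS]gk GE cE//.
apply: eq_integral_weight => //; first by move=> w; exact: fine_ge0.
(* With [\1_B] at position [k], only the factors listed in [s] may fail to be indicators, so the
   induction hypothesis applies. *)
move=> B mB; rewrite -GE -cE//.
apply: (IH (fun i => if i == k then \1_B else g i)).
- by move=> i; case: ifPn => // _; exact: measurable_indic.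
- by move=> i x; case: ifPn.
- move=> i; case: ifPn => // /eqP ->.
  rewrite integral_indic_comp// (le_lt_trans (probability_le1 _ _)) ?ltry//.
  by rewrite -[X in measurable X]setTI; exact: mX.
- move=> i nis; case: ifPn => [_|ik]; first by exists B.
  by apply: gI; rewrite inE negb_or ik.
Qed.

(** * Stability of independence under composition and reindexing *)

Lemma mutually_independent_comp (R : realType) (d : measure_display)
    (T : measurableType d) (P : probability T R) (I : finType)
    (X : I -> T -> R) (f : I -> R -> R) :
  (forall i, measurable_fun setT (f i)) -> mutually_independent P X ->
  mutually_independent P (fun i => f i \o X i).
Proof.
move=> mf indX B mB; apply: (indX (fun i => f i @^-1` B i)) => i.
by rewrite -[Y in measurable Y]setTI; exact: mf.
Qed.

(** Indices outside the image of [f] receive the full set [setT], hence a factor 1. On the image,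
    injectivity makes the chosen preimage unique. *)
Lemma mutually_independent_inj (R : realType) (d : measure_display)
    (T : measurableType d) (P : probability T R) (I J : finType)
    (X : I -> T -> R) (f : J -> I) :
  injective f -> mutually_independent P X ->
  mutually_independent P (fun j => X (f j)).
Proof.
move=> f_inj indX B mB.
pose B' i := if [pick j | f j == i] is Some j then B j else setT.
have B'f j : B' (f j) = B j.
  by rewrite /B'; case: pickP => [k /eqP/f_inj->//|/(_ j)]; rewrite eqxx.
have B'N i : i \notin codom f -> B' i = setT.
  rewrite /B'; case: pickP => // k /eqP <-.
  by rewrite codom_f.
have mB' i : measurable (B' i) by rewrite /B'; case: pickP.
have -> : [set w | forall j, B j (X (f j) w)] = [set w | forall i, B' i (X i w)].
  apply/seteqP; split => w BX i; last by have := BX (f i); rewrite B'f.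
  have [/codomP[j ->]|/B'N -> //] := boolP (i \in codom f).
  by rewrite B'f; exact: BX.
apply: (eq_trans (indX B' mB')).
rewrite (bigID (mem (codom f)))/= [X in (_ * X)%E]big1 ?mule1; last first.
  move=> i /B'N ->; have -> : [set w | [set: R] (X i w)] = setT by apply/seteqP.
  exact: probability_setT.
rewrite (eq_bigl (mem (imset f (mem predT)))); last first.
  by move=> i; apply/codomP/imsetP => [[j ->]|[j _ ->]]; exists j.
rewrite big_imset/=; last by move=> j k _ _ /f_inj.
by apply: eq_bigr => j _; rewrite B'f.
Qed.

(** * Hoeffding's inequality by the Chernoff method *)

Lemma expR_le_chord (R : realType) (l x : R) :
  0 <= x <= 1 -> expR (l * x) <= 1 - x + x * expR l.
Proof.
move=> /andP[x0 x1].
(* The exponential lies above its tangent at [l * x]. Averaging the bounds at 0 and [l] with weights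
   [1 - x] and [x] cancels the linear terms, since [l * x] is the average of these points. *)
have tangent t : expR (l * x) * (1 + (t - l * x)) <= expR t.
  rewrite -{2}(subrK (l * x) t) expRD mulrC ler_wpM2r ?expR_ge0//.
  exact: expR_ge1Dx.
have t0 := ler_wpM2l (_ : 0 <= 1 - x) (tangent 0).
have tl := ler_wpM2l x0 (tangent l).
have := lerD (t0 _) tl; rewrite subr_ge0 => /(_ x1).
by rewrite expR0 mulr1; apply: le_trans; rewrite le_eqVlt; apply/orP; left; apply/eqP; ring.
Qed.

Section hoeffding.
Context (R : realType) (d : measure_display) (T : measurableType d).
Variable P : probability T R.

(** Convexity bounds the moment generating function by that of a Bernoulli variable of the same mean
    [p], which [ln_bernoulli_mgf_le] controls. *)
Lemma mgf_le_hoeffding (X : T -> R) (p l : R) :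
  measurable_fun setT X -> (forall w, 0 <= X w <= 1) ->
  (\int[P]_w (X w)%:E = p%:E)%E -> 0 <= l ->
  (\int[P]_w (expR (l * X w))%:E <= (expR (p * l + l ^+ 2 / 8))%:E)%E.
Proof.
move=> mX X01 EX l0.
have X0 w : 0 <= X w by have /andP[] := X01 w.
have p01 : 0 <= p <= 1.
  rewrite -!lee_fin -EX; apply/andP; split.
    by apply: integral_ge0 => w _; rewrite lee_fin.
  rewrite -(probability_setT P) -[Y in (_ <= P Y)%E]setIT -integral_indic//.
  apply: ge0_le_integral => //.
  - by move=> w _; rewrite lee_fin.
  - by apply/measurable_EFinP.
  - by apply/measurable_EFinP.
  - by move=> w _; rewrite lee_fin indicE mem_set//; have /andP[] := X01 w.
have e1 : 0 <= expR l - 1 by rewrite subr_ge0 -expR0 ler_expR.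
have mEX : measurable_fun [set: T] (EFin \o X) by exact/measurable_EFinP.
(* The chord is arranged as a sum of two nonnegative terms, so that its integral splits by
   additivity for nonnegative functions. *)
apply: (@le_trans _ _ (\int[P]_w (1%:E + (expR l - 1)%:E * (X w)%:E))%E).
  apply: ge0_le_integral => //.
  - apply/measurable_EFinP; apply: measurableT_comp => //.
    exact: measurable_funM.
  - by apply: emeasurable_funD => //; exact: measurable_funeM.
  - move=> w _; rewrite -EFinM -EFinD lee_fin.
    apply: (le_trans (expR_le_chord _ l _ (X01 w))).
    by rewrite le_eqVlt; apply/orP; left; apply/eqP; ring.
rewrite ge0_integralD//; last 2 first.
- by move=> w _; rewrite -EFinM lee_fin mulr_ge0.
- exact: measurable_funeM.
rewrite ge0_integralZl_EFin//; last by move=> w _; rewrite lee_fin.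
rewrite EX integral_cst//= probability_setT mule1 -EFinM -EFinD lee_fin.
have -> : 1 + (expR l - 1) * p = 1 - p + p * expR l by ring.
have q0 : 0 < 1 - p + p * expR l.
  by move/andP : p01 => [p0 p1]; have := expR_ge1Dx l; nra.
by rewrite -ler_ln ?posrE ?expR_gt0// expRK ln_bernoulli_mgf_le.
Qed.

Lemma hoeffding_upper (I : finType) (X : I -> T -> R) (p : I -> R) (s : R) :
  mutually_independent P X -> (forall i, measurable_fun setT (X i)) ->
  (forall i w, 0 <= X i w <= 1) ->
  (forall i, \int[P]_w (X i w)%:E = (p i)%:E)%E ->
  (0 < #|I|)%N -> 0 < s ->
  (P [set w | (\sum_i p i + s <= \sum_i X i w)%R] <=
    (expR (- (2 * s ^+ 2 / #|I|%:R)))%:E)%E.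
Proof.
move=> indX mX X01 EX I0 s0.
have m0 : (0 : R) < #|I|%:R by rewrite ltr0n.
(* This [l] minimises the Chernoff exponent [#|I| * l ^+ 2 / 8 - l * s]; the minimum is
   [- 2 * s ^+ 2 / #|I|]. *)
pose l := 4 * s / #|I|%:R.
have l0 : 0 < l by rewrite divr_gt0// mulr_gt0.
pose S w := \sum_i X i w.
have mS : measurable_fun setT S by exact: measurable_sum.
pose mS_mixin := isMeasurableFun.Build _ _ _ _ S mS.
pose Y : {RV P >-> R} := HB.pack S mS_mixin.
apply: (le_trans (@chernoff _ _ _ P Y l (\sum_i p i + s) l0)).
have -> : ('M_P Y l = \prod_i \int[P]_w (expR (l * X i w))%:E)%E.
  rewrite /mmt_gen_fun unlock.
  rewrite -(@integral_prod_indep _ _ _ P I X (fun _ x => expR (l * x)))//.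
  - apply: eq_integral => w _; congr EFin.
    by rewrite /= mulrC mulr_sumr expR_sum.
  - move=> i; apply: measurableT_comp => //; exact: measurable_funM.
  - move=> i; apply: le_lt_trans (mgf_le_hoeffding _ _ _ (mX i) (X01 i) (EX i) (ltW l0)) _.
    exact: ltry.
apply: (@le_trans _ _ ((\prod_i expR (p i * l + l ^+ 2 / 8))%:E *
    (expR (- (l * (\sum_i p i + s))))%:E)%E).
  rewrite lee_wpmul2r ?lee_fin ?expR_ge0// -prodEFin.
  (* Nonnegativity is carried through the induction because multiplying the inequalities factor by
     factor requires it. *)
  suff /andP[] : (0 <= \prod_i \int[P]_w (expR (l * X i w))%:E <=
      \prod_i (expR (p i * l + l ^+ 2 / 8))%:E)%E by [].
  elim/big_rec2: _ => [|i a b _ /andP[b0 ba]]; first by rewrite lexx lee_fin ler01.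
  have E0 : (0 <= \int[P]_w (expR (l * X i w))%:E)%E.
    by apply: integral_ge0 => w _; rewrite lee_fin expR_ge0.
  rewrite mule_ge0//= lee_pmul//.
  exact: mgf_le_hoeffding (mX i) (X01 i) (EX i) (ltW l0).
rewrite -EFinM lee_fin -expR_sum -expRD ler_expR.
rewrite big_split/= sumr_const -mulr_suml -[_ *+ #|_|]mulr_natr.
rewrite le_eqVlt; apply/orP; left; apply/eqP; rewrite /l.
by field; rewrite gt_eqF.
Qed.

(** Reflection of the upper tail: the variables [1 - X i] are again independent with values in
    [0,1], and have means [1 - p i]. *)
Lemma hoeffding_lower (I : finType) (X : I -> T -> R) (p : I -> R) (s : R) :
  mutually_independent P X -> (forall i, measurable_fun setT (X i)) ->
  (forall i w, 0 <= X i w <= 1) ->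
  (forall i, \int[P]_w (X i w)%:E = (p i)%:E)%E ->
  (0 < #|I|)%N -> 0 < s ->
  (P [set w | (\sum_i X i w + s <= \sum_i p i)%R] <=
    (expR (- (2 * s ^+ 2 / #|I|%:R)))%:E)%E.
Proof.
move=> indX mX X01 EX I0 s0.
have -> : [set w | \sum_i X i w + s <= \sum_i p i] =
    [set w | \sum_i (1 - p i) + s <= \sum_i (1 - X i w)].
  by apply/seteqP; split => w /=; rewrite !sumrB; lra.
have m1 : measurable_fun [set: R] (fun x : R => 1 - x).
  exact: measurable_funB.
apply: (@hoeffding_upper I (fun i w => 1 - X i w)) => //.
- exact: (@mutually_independent_comp _ _ _ P I X (fun _ x => 1 - x)).
- by move=> i; exact: measurable_funB.
- by move=> i w; have /andP[] := X01 i w; lra.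
- move=> i; under eq_integral do rewrite EFinB.
  rewrite integralB_EFin//; last 2 first.
  + exact: finite_measure_integrable_cst.
  + apply/integrableP; split; first exact/measurable_EFinP.
    under eq_integral do rewrite gee0_abs ?lee_fin ?(andP (X01 _ _)).1//.
    by rewrite EX ltry.
  by rewrite EX integral_cst//= probability_setT mule1.
Qed.

End hoeffding.

(** * Union bound and change of variables *)

Lemma measure_bigsetU_le (R : realType) (d : measure_display)
    (T : measurableType d) (P : {measure set T -> \bar R}) (I : finType)
    (F : I -> set T) :
  (forall i, measurable (F i)) ->
  (P (\big[setU/set0]_i F i) <= \sum_i P (F i))%E.
Proof.
move=> mF; elim: (index_enum I) => [|i s IH]; first by rewrite !big_nil measure0.
rewrite !big_cons; apply: le_trans (measureU2 P (mF i) _) _.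
  exact: bigsetU_measurable.
by rewrite leeD2l.
Qed.

(** Change of variables along [X], whose law is [D]. Two integrands occur because the utility is
    controlled only on nonnegative arguments: [g] is a globally measurable function that agrees with
    [f] there. *)
Lemma integral_nonneg_law (R : realType) (d : measure_display)
    (T : measurableType d) (P : probability T R) (D : probability R R)
    (X : T -> R) (f g : R -> R) :
  measurable_fun setT X -> (forall w, 0 <= X w) ->
  (forall B, measurable B -> P (X @^-1` B) = D B) ->
  measurable_fun setT g -> (forall t, 0 <= g t) ->
  (forall t, 0 <= t -> f t = g t) ->
  (\int[D]_(t in @nonneg_reals R) (f t)%:E = \int[P]_w (g (X w))%:E)%E.
Proof.
move=> mX X0 XD mg g0 fg.
have mN : measurable (@nonneg_reals R).
  have -> : @nonneg_reals R = `[0, +oo[%classic.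
    by apply/seteqP; split => t /=; rewrite in_itv/= andbT.
  exact: measurable_itv.
pose mX_mixin := isMeasurableFun.Build _ _ _ _ X mX.
pose Y : {mfun T >-> R} := HB.pack X mX_mixin.
rewrite (eq_measure_integral (pushforward P Y)); last first.
  by move=> B mB _; apply/esym; exact: XD.
rewrite (eq_integral (fun t => (g t)%:E)); last first.
  by move=> t /set_mem /fg ->.
rewrite ge0_integral_pushforward//; last 2 first.
- by apply/measurable_EFinP; exact: measurable_funTS.
- by move=> t _; rewrite lee_fin.
by have -> : Y @^-1` @nonneg_reals R = setT by apply/seteqP; split => w //= _; exact: X0.
Qed.

(** * Comparison of capped and uncapped utility *)

Section capped_utility.
Context (R : realType) (u : R -> R) (kappa : R).
Hypothesis u01 : forall t, 0 <= t -> 0 <= u t <= 1.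
Hypothesis u_ni : forall s t, 0 <= s -> s <= t -> u t <= u s.
Hypothesis kappa0 : 0 <= kappa.

(* [u] is unconstrained on negative arguments, hence the truncation at 0. *)
Definition utility0 (t : R) : R := u (Num.max 0 t).

Definition capped_utility (t : R) : R := utility0 (Num.min t kappa).

Let max0_ge0 (t : R) : 0 <= Num.max 0 t.
Proof. by rewrite le_max lexx. Qed.

Lemma utility0_ni : {homo utility0 : s t /~ s <= t}.
Proof. by move=> s t st; apply: u_ni => //; rewrite le_max2// lexx. Qed.

Lemma measurable_utility0 : measurable_fun setT utility0.
Proof. by apply: nonincreasing_measurable => // s t; exact: utility0_ni. Qed.

Lemma measurable_capped_utility : measurable_fun setT capped_utility.
Proof.
apply: nonincreasing_measurable => // s t st; apply: utility0_ni.
by rewrite le_min2.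
Qed.

Lemma utility0E t : 0 <= t -> utility0 t = u t.
Proof. by move=> t0; rewrite /utility0 max_r. Qed.

Lemma capped_utilityE t : 0 <= t -> capped_utility t = u (Num.min t kappa).
Proof. by move=> t0; rewrite /capped_utility utility0E// le_min t0. Qed.

Lemma utility0_01 t : 0 <= utility0 t <= 1.
Proof. exact: u01. Qed.

Lemma capped_utility_01 t : 0 <= capped_utility t <= 1.
Proof. exact: u01. Qed.

Lemma utility0_le_capped t : utility0 t <= capped_utility t.
Proof. by apply: utility0_ni; rewrite ge_min lexx. Qed.

(** Capping changes the utility only past [kappa], where it replaces a nonnegative value by
    [u kappa]. *)
Lemma capped_le_utility0 t : capped_utility t <= utility0 t + u kappa.
Proof.
have [tk|kt] := leP t kappa.
- by rewrite /capped_utility min_l// lerDl; have /andP[] := u01 _ kappa0.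
- rewrite /capped_utility (min_r (ltW kt)) (utility0E _ kappa0). rewrite lerDr.
  by have /andP[] := utility0_01 t.
Qed.

End capped_utility.

(** * Guarantees of the Naive procedure *)

Lemma le_naive_m (R : realType) (n : nat) (delta eps ukappa : R) :
  2 * ln (2 * n%:R / delta) / (eps - ukappa) ^+ 2 <=
  (naive_m n delta eps ukappa)%:R.
Proof.
rewrite /naive_m natr_absz; apply: le_trans (ceil_ge _) _.
by rewrite ler_int ler_norm.
Qed.

(** The sample count is any positive [m] large enough for the tail bounds, which keeps the ceiling
    out of the argument. [A] is the complement of the tail events; on it every maximiser is covered,
    however ties are broken. *)
Lemma naive_good_event (R : realType) (d : measure_display)
    (T : measurableType d) (P : probability T R) (u : R -> R) (n m : nat)
    (D : 'I_n -> probability R R) (eps delta kappa : R)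
    (X : 'I_n -> 'I_m -> T -> R) :
  (0 < n)%N -> (0 < m)%N ->
  (forall t, 0 <= t -> 0 <= u t <= 1) ->
  (forall s t, 0 <= s -> s <= t -> u t <= u s) ->
  0 < delta -> 0 <= kappa -> u kappa < eps ->
  2 * ln (2 * n%:R / delta) <= m%:R * (eps - u kappa) ^+ 2 ->
  (forall i j, measurable_fun setT (X i j)) ->
  (forall i j w, 0 <= X i j w) ->
  (forall i j B, measurable B -> P (X i j @^-1` B) = D i B) ->
  mutually_independent P (fun ij : 'I_n * 'I_m => X ij.1 ij.2) ->
  exists A : set T, measurable A /\
    A `<=` [set w | forall i : 'I_n,
      (forall k, emp_utility u kappa (X k ^~ w) <= emp_utility u kappa (X i ^~ w)) ->
      forall k, (expected_utility (D k) u <= expected_utility (D i) u + eps%:E)%E] /\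
    ((1 - delta)%:E <= P A)%E.
Proof.
move=> n0 m0 u01 u_ni delta0 kappa0 ueps m_large mX X0 XD indX.
have m0R : 0 < m%:R :> R by rewrite ltr0n.
have n0R : 0 < n%:R :> R by rewrite ltr0n.
pose g := eps - u kappa; have g0 : 0 < g by rewrite subr_gt0.
pose v := capped_utility R u kappa.
pose Y i j w := v (X i j w).
have v01 t : 0 <= v t <= 1 by exact: capped_utility_01.
have mv : measurable_fun setT v by exact: measurable_capped_utility.
have mY i j : measurable_fun setT (Y i j) by exact: measurableT_comp.
pose EP (f : R -> R) i := (\int[D i]_(t in @nonneg_reals R) (f t)%:E)%E.
have EPE (f h : R -> R) i j : measurable_fun setT h -> (forall t, 0 <= h t) ->
    (forall t, 0 <= t -> f t = h t) -> (EP f i = \int[P]_w (h (X i j w))%:E)%E.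
  by move=> mh h0 fh; exact: (integral_nonneg_law _ _ _ P (D i) (X i j) f h (mX i j) (X0 i j) (XD i j)).
have v0 t : 0 <= v t by have /andP[] := v01 t.
have u00 t : 0 <= utility0 R u t by have /andP[] := utility0_01 _ _ u01 t.
have mu0 := measurable_utility0 _ _ u_ni.
pose p i := fine (EP v i).
have EY i j : (\int[P]_w (Y i j w)%:E = (p i)%:E)%E.
  rewrite /p (EPE v v i j)// fineK// ge0_fin_numE; last first.
    by apply: integral_ge0 => w _; rewrite lee_fin.
  apply: (@le_lt_trans _ _ (\int[P]_w (cst 1%:E w))%E).
    apply: ge0_le_integral => //.
    - by move=> w _; rewrite lee_fin.
    - by apply/measurable_EFinP; exact: mY.
    - by move=> w _; rewrite lee_fin; have /andP[] := v01 (X i j w).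
  by rewrite integral_cst//= probability_setT mule1 ltry.
(* All samples of one algorithm share its law, so a single index suffices to express [U_i] as an
   integral over [P]. *)
have j0 : 'I_m := Ordinal m0.
have UE i : (expected_utility (D i) u = \int[P]_w (utility0 R u (X i j0 w))%:E)%E.
  by apply: EPE => // t t0; rewrite utility0E.
have U_le i : (expected_utility (D i) u <= (p i)%:E)%E.
  rewrite UE -(EY i j0); apply: ge0_le_integral => //.
  - by move=> w _; rewrite lee_fin.
  - by apply/measurable_EFinP; exact: measurableT_comp.
  - by apply/measurable_EFinP; exact: mY.
  - by move=> w _; rewrite lee_fin; exact: utility0_le_capped.
have le_U i : ((p i)%:E <= expected_utility (D i) u + (u kappa)%:E)%E.
  have uk0 : 0 <= u kappa by have /andP[] := u01 _ kappa0.
  rewrite UE -(EY i j0).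
  have -> : ((u kappa)%:E = \int[P]_w (cst (u kappa)%:E w))%E.
    by rewrite integral_cst//= probability_setT mule1.
  have mU : measurable_fun setT (fun w => (utility0 R u (X i j0 w))%:E).
    by apply/measurable_EFinP; exact: measurableT_comp.
  rewrite -ge0_integralD//; last by move=> w _; rewrite lee_fin.
  apply: ge0_le_integral => //.
  - by move=> w _; rewrite lee_fin; exact: v0.
  - by apply/measurable_EFinP; exact: mY.
  - exact: emeasurable_funD.
  - by move=> w _; rewrite lee_fin; exact: capped_le_utility0.
have indY i : mutually_independent P (Y i).
  apply: (@mutually_independent_comp _ _ _ P _ (X i) (fun=> v)) => //.
  by apply: (@mutually_independent_inj _ _ _ P _ _ _ (fun j => (i, j))) indX => j k [].
(* Sums are compared instead of means, so the deviation [g / 2] is scaled by [m]; the Hoeffding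
   exponent [2 * t ^+ 2 / m] becomes [m * g ^+ 2 / 2]. *)
pose t := m%:R * g / 2.
have t0 : 0 < t by rewrite divr_gt0// mulr_gt0.
have tail : expR (- (2 * t ^+ 2 / #|'I_m|%:R)) <= delta / (2 * n%:R).
  have -> : delta / (2 * n%:R) = expR (- ln (2 * n%:R / delta)).
    by rewrite expRN lnK ?invf_div// posrE divr_gt0// mulr_gt0.
  rewrite ler_expR lerN2 card_ord /t.
  have -> : 2 * (m%:R * g / 2) ^+ 2 / m%:R = m%:R * g ^+ 2 / 2.
    by field; rewrite gt_eqF.
  by rewrite ler_pdivlMr// mulrC.
pose up i := [set w | \sum_(j < m) p i + t <= \sum_j Y i j w].
pose low i := [set w | \sum_j Y i j w + t <= \sum_(j < m) p i].
have mS i : measurable_fun setT (fun w => \sum_j Y i j w).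
  exact: measurable_sum.
have mup i : measurable (up i).
  rewrite -[X in measurable X]setTI; apply: measurable_fun_le => //.
have mlow i : measurable (low i).
  rewrite -[X in measurable X]setTI; apply: measurable_fun_le => //.
  exact: measurable_funD.
have m_card : (0 < #|'I_m|)%N by rewrite card_ord.
have Pup i : (P (up i) <= (delta / (2 * n%:R))%:E)%E.
  apply: (@le_trans _ _ (expR (- (2 * t ^+ 2 / #|'I_m|%:R)))%:E).
    exact: (hoeffding_upper _ _ _ P _ (Y i) (fun=> p i) t (indY i) (mY i)
      (fun j w => v01 (X i j w)) (EY i) m_card t0).
  by rewrite lee_fin.
have Plow i : (P (low i) <= (delta / (2 * n%:R))%:E)%E.
  apply: (@le_trans _ _ (expR (- (2 * t ^+ 2 / #|'I_m|%:R)))%:E).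
    exact: (hoeffding_lower _ _ _ P _ (Y i) (fun=> p i) t (indY i) (mY i)
      (fun j w => v01 (X i j w)) (EY i) m_card t0).
  by rewrite lee_fin.
pose bad := \big[setU/set0]_(i < n) (up i `|` low i).
have mbad : measurable bad.
  by apply: bigsetU_measurable => i _; exact: measurableU.
have Pbad : (P bad <= delta%:E)%E.
  apply: le_trans (measure_bigsetU_le _ _ _ P _ _ _) _.
    by move=> i; exact: measurableU.
  have Pi i : (P (up i `|` low i) <= (delta / n%:R)%:E)%E.
    apply: le_trans (measureU2 P (mup i) (mlow i)) _.
    have -> : delta / n%:R = delta / (2 * n%:R) + delta / (2 * n%:R).
      by field; rewrite pnatr_eq0 -lt0n.
    by rewrite EFinD; exact: leeD (Pup i) (Plow i).
  apply: le_trans (lee_sum _ (fun i _ => Pi i)) _.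
  by rewrite sumEFin lee_fin sumr_const card_ord -[leLHS]mulr_natr divfK// gt_eqF.
exists (~` bad); split; first exact: measurableC.
split; last first.
  rewrite probability_setC// EFinB leeB//.
move=> w nbad i i_max k.
have close l : \sum_j Y l j w < m%:R * p l + t /\ m%:R * p l < \sum_j Y l j w + t.
  have nb : ~ (up l `|` low l) w.
    move=> b; apply: nbad; rewrite /bad -bigcup_seq; exists l => //.
    by rewrite /= mem_index_enum.
  have Ep : \sum_(j < m) p l = m%:R * p l.
    by rewrite sumr_const card_ord mulr_natl.
  rewrite -Ep; split; rewrite ltNge; apply/negP => b; apply: nb.
  - by left.
  - by right.
have empE l : emp_utility u kappa (X l ^~ w) = m%:R^-1 * \sum_j Y l j w.
  congr (_ * _); apply: eq_bigr => j _.
  by rewrite /Y /v capped_utilityE.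
have := i_max k; rewrite !empE ler_pM2l ?invr_gt0// => Yki.
have [_ k_close] := close k; have [i_close _] := close i.
(* With [S] the sum of the capped utilities: [m p_k < S_k + t <= S_i + t < m p_i + 2 t = m (p_i +
   g)]. *)
have pki : p k <= p i + g.
  rewrite -(ler_pM2l m0R) mulrDr.
  have : t + t = m%:R * g by rewrite /t; field.
  lra.
(* The chain is [U_k <= p_k <= p_i + g <= U_i + u kappa + g = U_i + eps]. *)
apply: le_trans (U_le k) _.
apply: (@le_trans _ _ ((p i)%:E + g%:E)%E); first by rewrite -EFinD lee_fin.
apply: le_trans (leeD2r g%:E (le_U i)) _.
have gE : u kappa + g = eps by rewrite /g; ring.
by rewrite -addeA -EFinD gE.
Qed.

Theorem theorem3 (R : realType) (d : measure_display) (T : measurableType d)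
  (P : probability T R) (u : R -> R) (n : nat) (D : 'I_n -> probability R R)
  (eps delta kappa : R)
  (X : 'I_n -> 'I_(naive_m n delta eps (u kappa)) -> T -> R) :
  (0 < n)%N ->
  (forall t, 0 <= t -> 0 <= u t <= 1) ->
  (forall s t, 0 <= s -> s <= t -> u t <= u s) ->
  u 0 = 1 ->
  (u t @[t --> +oo] --> 0) ->
  0 < eps < 1 -> 0 < delta < 1 ->
  0 <= kappa -> u kappa < eps ->
  (forall i j, measurable_fun setT (X i j)) ->
  (forall i j w, 0 <= X i j w) ->
  (forall i j B, measurable B -> P (X i j @^-1` B) = D i B) ->
  mutually_independent P (fun ij : 'I_n * 'I_(naive_m n delta eps (u kappa)) =>
                            X ij.1 ij.2) ->
  (exists A : set T, measurable A /\
     A `<=` [set w | forall i : 'I_n,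
       (forall k, emp_utility u kappa (X k ^~ w) <= emp_utility u kappa (X i ^~ w)) ->
       forall k, (expected_utility (D k) u <= expected_utility (D i) u + eps%:E)%E] /\
     ((1 - delta)%:E <= P A)%E)
  /\
  2 * Num.sqrt (ln (2 * n%:R / delta) / (2 * (naive_m n delta eps (u kappa))%:R))
    + u kappa <= eps.
Proof.
move=> n0 u01 u_ni _ _ _ /andP[delta0 delta1] kappa0 ueps mX X0 XD indX.
set L := ln (2 * n%:R / delta).
have g0 : 0 < eps - u kappa by rewrite subr_gt0.
have n1 : 1 <= n%:R :> R by rewrite ler1n.
have L0 : 0 < L by rewrite ln_gt0// ltr_pdivlMr//; lra.
have m_ge := le_naive_m R n delta eps (u kappa).
(* Since [delta < 1 <= n], the logarithm [L] is positive; hence at least one sample is taken and the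
   divisions by [m] are genuine. *)
have m0R : 0 < (naive_m n delta eps (u kappa))%:R :> R.
  by apply: lt_le_trans m_ge; rewrite divr_gt0 ?exprn_gt0 ?mulr_gt0.
have m_large : 2 * L <= (naive_m n delta eps (u kappa))%:R * (eps - u kappa) ^+ 2.
  by rewrite -ler_pdivrMr ?exprn_gt0.
split.
  by apply: naive_good_event => //; rewrite -(ltr0n R).
(* The claim becomes [sqrt (L / (2 m)) <= g / 2] with [g = eps - u kappa]; after squaring, this is
   [m_large]. *)
rewrite -lerBrDr mulrC -ler_pdivlMr//.
have g2_ge0 : 0 <= (eps - u kappa) / 2 by rewrite divr_ge0// ltW.
rewrite -(ger0_norm g2_ge0) -sqrtr_sqr ler_wsqrtr// ler_pdivrMr ?mulr_gt0//.
by lra.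
Qed.
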